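(* Every real polynomial $p(t)$ of degree $n\geq 1$ can be factorized as $$p(t)=a\cdot L_1(t)\cdots L_m(t)\cdot Q_1(t)\cdots Q_k(t),$$ where $m,k\in\mathbb{N}\cup\{0\}$, $a\in\mathbb{R}$, each $L_i(t)$ is a linear real polynomial, and each $Q_j(t)$ is a quadratic real polynomial with negative discriminant.
   Context: A real polynomial is a polynomial in a single variable $t$ with real coefficients. A linear polynomial is one of degree exactly $1$, and a quadratic polynomial is one of degree exactly $2$. The discriminant of $at^2+bt+c$ is $b^2-4ac$. Either $m$ or $k$ may be $0$, in which case the corresponding product is empty. *)

(* Defs.v *)
From mathcomp Require Import all_boot all_order all_algebra.
From mathcomp Require Import reals.

Set Implicit Arguments.
Unset Strict Implicit.
Unset Printing Implicit Defensive.

Import GRing.Theory.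
Local Open Scope ring_scope.

(* [size p] is the degree plus one, and [size 0 = 0]; hence the zero polynomial
   has no degree here. *)
Definition has_degree (R : realType) (p : {poly R}) (n : nat) : Prop :=
  size p = n.+1.

Definition linear_poly (R : realType) (p : {poly R}) : Prop := has_degree p 1.

Definition quadratic_poly (R : realType) (p : {poly R}) : Prop := has_degree p 2.

(* For p = a t^2 + b t + c one has a = p`_2, b = p`_1, c = p`_0. *)
Definition discriminant (R : realType) (p : {poly R}) : R :=
  p`_1 ^+ 2 - 4%:R * p`_2 * p`_0.

(* Main.v *)
Require Import Defs.
From mathcomp Require Import all_boot all_order all_algebra.
From mathcomp Require Import reals complex.
From mathcomp Require Import ring.

Set Implicit Arguments.
Unset Strict Implicit.
Unset Printing Implicit Defensive.

Import Order.TTheory GRing.Theory Num.Theory.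
Local Open Scope ring_scope.

(** The field [R[i]] is algebraically closed, so [p] has a complex root
    [x + i y].  If [y = 0] then ['X - x] divides [p]; otherwise the remainder of
    [p] modulo [('X - x)^2 + y^2] is an affine real polynomial vanishing at the
    non-real point [x + i y], hence zero.  Induct on the degree of the
    quotient. *)

Section RealFactors.

Variable R : rcfType.

(** The product [(t - z)(t - z')] for the conjugate pair [z, z' = x ± iy], written over the
    reals. *)
Definition conj_pair_poly (x y : R) : {poly R} :=
  ('X - x%:P) ^+ 2 + (y ^+ 2)%:P.

Lemma conj_pair_polyE (x y : R) :
  conj_pair_poly x y = Poly [:: x ^+ 2 + y ^+ 2; - (x *+ 2); 1].
Proof.
rewrite /conj_pair_poly /= !cons_poly_def mul0r add0r.
rewrite polyCN polyCMn polyCD !polyC_exp polyC1; ring.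
Qed.

Lemma size_conj_pair_poly (x y : R) : size (conj_pair_poly x y) = 3%N.
Proof.
by rewrite conj_pair_polyE (@PolyK _ 0) //= oner_neq0.
Qed.

(** At [x + iy] the imaginary part of [r] is [r_1 y], which forces [r_1 = 0]; the real part then
    leaves [r_0 = 0]. *)
Lemma affine_nonreal_root (r : {poly R}) (x y : R) :
  (size r <= 2)%N -> y != 0 ->
  root (map_poly (real_complex R) r) (x +i* y)%C -> r = 0.
Proof.
move=> sr y0; have -> : r = Poly [:: r`_0; r`_1].
  apply/polyP => i; rewrite coef_Poly.
  case: i => [|[|i]] //=; rewrite nth_nil nth_default //.
  exact: leq_trans sr _.
rewrite /= !cons_poly_def mul0r add0r.
rewrite rmorphD rmorphM /= map_polyX !map_polyC /= /root !hornerE /=.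
rewrite eq_complex /= => /andP[/eqP h1 /eqP h2].
have r1 : r`_1 = 0.
  by apply: (mulIf y0); move: h2; rewrite !mul0r !addr0.
have r0 : r`_0 = 0 by move: h1; rewrite r1 !mul0r subr0 add0r.
by rewrite r0 r1 mul0r addr0.
Qed.

Lemma conj_pair_poly_dvdp (p : {poly R}) (x y : R) : y != 0 ->
  root (map_poly (real_complex R) p) (x +i* y)%C -> conj_pair_poly x y %| p.
Proof.
move=> y0 rp; apply/eqP; apply: (@affine_nonreal_root _ x y _ y0).
  rewrite -ltnS -(size_conj_pair_poly x y) ltn_modp.
  by rewrite -size_poly_eq0 size_conj_pair_poly.
(* Evaluate the division identity at [x + iy]: the divisor vanishes there, so the root passes from
   [p] to the remainder. *)
move: rp; rewrite {1}(divp_eq p (conj_pair_poly x y)) /root.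
rewrite rmorphD rmorphM /= hornerD hornerM.
suff -> : (map_poly (real_complex R) (conj_pair_poly x y)).[(x +i* y)%C] = 0.
  by rewrite mulr0 add0r.
rewrite /conj_pair_poly rmorphD rmorphXn rmorphB /= map_polyX !map_polyC /=.
rewrite !hornerE /=; apply/eqP; rewrite eq_complex /=.
by apply/andP; split; apply/eqP; ring.
Qed.

Lemma real_factor (p : {poly R}) : (1 < size p)%N ->
  (exists x, 'X - x%:P %| p) \/
  (exists x y, y != 0 /\ conj_pair_poly x y %| p).
Proof.
move=> sp; have /closed_rootP [[x y] rz] :
    size (map_poly (real_complex R) p) != 1%N by rewrite size_map_poly gtn_eqF.
have [y0|y0] := eqVneq y 0; last first.
  by right; exists x, y; split=> //; apply: conj_pair_poly_dvdp.
(* With [y = 0] the root is the image of [x] under the embedding of [R], which is injective, so [x]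
   is already a root of [p] over [R]. *)
by left; exists x; move: rz; rewrite y0 dvdp_XsubCl fmorph_root.
Qed.

End RealFactors.

Lemma conj_pair_quadratic (R : realType) (x y : R) : y != 0 ->
  quadratic_poly (conj_pair_poly x y) /\ discriminant (conj_pair_poly x y) < 0.
Proof.
move=> y0; split; first exact: size_conj_pair_poly.
rewrite /discriminant conj_pair_polyE !coef_Poly /=.
have -> : (- (x *+ 2)) ^+ 2 - 4%:R * 1 * (x ^+ 2 + y ^+ 2) = - (4%:R * y ^+ 2).
  by ring.
by rewrite oppr_lt0 mulr_gt0 // exprn_even_gt0.
Qed.

Lemma real_poly_factorization_seq (R : realType) (p : {poly R}) : p != 0 ->
  exists (a : R) (sL sQ : seq {poly R}),
    [/\ forall q, q \in sL -> linear_poly q,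
        forall q, q \in sQ -> quadratic_poly q /\ discriminant q < 0
      & p = a%:P * (\prod_(q <- sL) q) * (\prod_(q <- sQ) q)].
Proof.
have [n] := ubnP (size p); elim: n p => // n IHn p sp p0.
have [sp1|sp1] := leqP (size p) 1.
  exists p`_0, [::], [::]; split=> //.
  by rewrite !big_nil !mulr1; apply: size1_polyC.
(* The quotient loses [size d - 1 > 0] in size and stays nonzero, so the induction hypothesis
   applies to it in both cases below. *)
have quo_lt (d : {poly R}) : (1 < size d)%N -> d %| p ->
    (size (p %/ d)%R < n)%N /\ p %/ d != 0.
  move=> sd dp; have d0 : d != 0 by rewrite -size_poly_gt0 ltnW.
  split; last by rewrite dvdp_div_eq0.
  rewrite size_divp // -ltnS; apply: leq_trans sp; rewrite ltnS.
  by rewrite ltn_subrL -subn1 subn_gt0 sd size_poly_gt0.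
have [[x xp]|[x [y [y0 qp]]]] := real_factor sp1.
  have [|sq q0] := quo_lt _ _ xp; first by rewrite size_XsubC.
  have [a [sL [sQ [hL hQ e]]]] := IHn _ sq q0.
  exists a, ('X - x%:P :: sL), sQ; split=> //.
    move=> q; rewrite inE => /orP[/eqP ->|]; last exact: hL.
    exact: size_XsubC.
  by rewrite big_cons -(divpK xp) e; ring.
have [|sq q0] := quo_lt _ _ qp; first by rewrite size_conj_pair_poly.
have [a [sL [sQ [hL hQ e]]]] := IHn _ sq q0.
exists a, sL, (conj_pair_poly x y :: sQ); split=> //.
  move=> q; rewrite inE => /orP[/eqP ->|]; last exact: hQ.
  exact: conj_pair_quadratic.
by rewrite big_cons -(divpK qp) e; ring.
Qed.

Theorem theorem3 (R : realType) (n : nat) (p : {poly R})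
    (hn : (1 <= n)%N) (hp : has_degree p n) :
  exists (m k : nat) (a : R) (L : 'I_m -> {poly R}) (Q : 'I_k -> {poly R}),
    [/\ forall i : 'I_m, linear_poly (L i),
        forall j : 'I_k, quadratic_poly (Q j) /\ discriminant (Q j) < 0
      & p = a%:P * (\prod_(i < m) L i) * (\prod_(j < k) Q j)].
Proof.
have p0 : p != 0 by rewrite -size_poly_eq0 hp.
have [a [sL [sQ [hL hQ e]]]] := real_poly_factorization_seq p0.
(* The lists are reread as families indexed by ordinals; [big_tuple] matches the two forms of the
   products. *)
exists (size sL), (size sQ), a, (tnth (in_tuple sL)), (tnth (in_tuple sQ)).
split=> [i|j|]; first exact/hL/mem_tnth.
  exact/hQ/mem_tnth.
by rewrite e -!(big_tuple _ _ _ predT id).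
Qed.
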